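(* Let $m \geqslant 1$ be an integer. Assume that an $m$-pyramidal Kirkman triple system can be realized under a nontrivial group $G$. Then $G$ has precisely $m$ involutions, and the involutions of $G$ are pairwise conjugate in $G$.
   Context: A Steiner triple system of order $v$ is a pair $(V,\mathfrak{B})$ where $V$ is a (finite) set of $v$ points and $\mathfrak{B}$ is a set of $3$-subsets (blocks) of $V$ such that any two distinct points are contained in exactly one block. A Kirkman triple system of order $v$ is a Steiner triple system $(V,\mathfrak{B})$ of order $v$ together with a resolution, that is, a partition $R$ of $\mathfrak{B}$ into classes (parallel classes), each of which is a partition of the point set $V$. An automorphism of a Kirkman triple system is a permutation of the point set that sends blocks to blocks and parallel classes to parallel classes. A Kirkman triple system is called $m$-pyramidal if there is a subgroup $G$ of its automorphism group that fixes (each of) $m$ points and acts regularly (sharply transitively) on the other points; in this case the Kirkman triple system is said to be realized under $G$. An involution is a group element of order $2$. All groups are finite. *)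

(* Defs.v *)
From HB Require Import structures.
From mathcomp Require Import all_boot all_order all_fingroup.

Set Implicit Arguments.
Unset Strict Implicit.
Unset Printing Implicit Defensive.

Import GroupScope.

Section KirkmanTripleSystems.

Variable V : finType.
Implicit Types (B : {set {set V}}) (R : {set {set {set V}}}) (S : {set V}).

Definition steiner_triple_system B : Prop :=
  (forall b, b \in B -> #|b| = 3) /\
  (forall x y, x != y -> exists! b, b \in B /\ [set x; y] \subset b).

Definition resolution B R : Prop :=
  partition R B /\ (forall P, P \in R -> partition P [set: V]).

Definition kirkman_triple_system B R : Prop :=
  steiner_triple_system B /\ resolution B R.

(* As V is finite, a permutation mapping B into B (resp. R into R) maps it
   bijectively onto itself, so this set is closed under inverses. *)
Definition kts_aut B R : {set {perm V}} :=
  [set s : {perm V} | [forall b in B, s @: b \in B]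
                   && [forall P in R, [set s @: b | b : {set V} in P] \in R]].

Definition sharply_transitive_on (G : {set {perm V}}) S : Prop :=
  {in S &, forall x y, exists! g, g \in G /\ g x = y}.

Definition pyramidal_under (m : nat) B R (G : {group {perm V}}) : Prop :=
  G \subset kts_aut B R /\
  exists F : {set V},
    [/\ #|F| = m,
        {in G & F, forall (g : {perm V}) x, g x = x}
      & sharply_transitive_on G (~: F)].

End KirkmanTripleSystems.

(* G is an abstract group, identified with a group of permutations of the
   points up to isomorphism. *)
Definition pyramidal_kts_realized_under (m : nat) (gT : finGroupType)
    (G : {group gT}) : Prop :=
  exists (V : finType) (B : {set {set V}}) (R : {set {set {set V}}})
         (H : {group {perm V}}),
    [/\ kirkman_triple_system B R, pyramidal_under m B R H & G \isog H].

Definition involutions (gT : finGroupType) (G : {set gT}) : {set gT} :=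
  [set x in G | #[x] == 2].

(* Main.v *)
Require Import Defs.
From mathcomp Require Import all_boot all_order all_fingroup.
From mathcomp Require Import cyclic.

Set Implicit Arguments.
Unset Strict Implicit.
Unset Printing Implicit Defensive.

Import GroupScope.

(** Write [F] for the set of [m] fixed points and fix a point [x] outside [F].
    As [G] acts regularly off [F], an element [g] of [G] is known as soon as
    [g x] is known.

    Counting only needs the Steiner property.  If [s] is an involution, it
    swaps [x] and [s x], hence preserves the block through them, hence fixes
    its third point, which is therefore in [F] ([fixed_point_of_involution]).
    Conversely, if [z] is in [F], the third point of the block through [x] and
    [z] is [s x] for some [s], and since [s] sends the pair [z, x] to the pair
    [z, s x] it preserves that block and must swap [x] and [s x]: it is an
    involution ([involution_of_fixed_point]).  So the involutions of [G]
    correspond to the points of [F] ([card_involutions]).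

    Conjugacy ([involutions_conjugate]) uses the resolution.  Let [s] and [t]
    be involutions, associated in this way with [z] and [w] in [F].  The
    parallel class [P] of the block {x, s x, z} is preserved by [s], hence so
    is the block [c] of [P] through the fixed point [w].
    - If [c] contains a point [h x] outside [F], it also contains [s (h x)];
      moving [c] back by the inverse of [h] gives a block through [w], [x] and
      the image of [x] under a conjugate of [s].  The block through [w] and [x]
      is {x, t x, w}, so that conjugate is [t].
    - Otherwise [c] is contained in [F], so [t] fixes [c], hence preserves [P],
      hence preserves the block of [P] through the fixed point [z]; this block
      is {x, s x, z}, and it contains [t x], so [t = s]. *)

(** * Points of a three-element set *)

Lemma third_point (T : finType) (b : {set T}) (x y : T) :
  #|b| = 3 -> exists z, [/\ z \in b, z != x & z != y].
Proof.
move=> b3; have: 0 < #|b :\: [set x; y]|.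
  rewrite cardsD b3 subn_gt0.
  apply: leq_ltn_trans (subset_leq_card (subsetIr _ _)) _.
  by rewrite cards2; case: eqP.
case/card_gt0P=> z; rewrite !inE negb_or => /andP[/andP[zx zy] zb].
by exists z.
Qed.

Lemma eq_third_point (T : finType) (b : {set T}) (x y z w : T) :
    #|b| = 3 -> x \in b -> y \in b -> z \in b -> w \in b ->
    x != y -> z != x -> z != y -> w != x -> w != y ->
  w = z.
Proof.
move=> b3 xb yb zb wb xy zx zy wx wy; apply/eqP; apply: contraT => wz.
have: [set w; z; x; y] \subset b.
  by apply/subsetP=> u; rewrite !inE => /orP[/orP[/orP[]|]|] /eqP->.
move/subset_leq_card; rewrite b3 -setUA cardsU !cards2 wz xy.
have ->: [set w; z] :&: [set x; y] = set0; last by rewrite cards0.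
apply/setP=> u; rewrite !inE; apply/negbTE/negP.
case/andP=> /orP[] /eqP-> /orP[].
- by rewrite (negbTE wx).
- by rewrite (negbTE wy).
- by rewrite (negbTE zx).
- by rewrite (negbTE zy).
Qed.

(** * Blocks and involutions of a pyramidal system *)

Section Pyramidal.

Variables (V : finType) (B : {set {set V}}) (R : {set {set {set V}}}).
Variables (G : {group {perm V}}) (F : {set V}).
Hypothesis kts : kirkman_triple_system B R.
Hypothesis autG : G \subset kts_aut B R.
Hypothesis fixG : {in G & F, forall (g : {perm V}) x, g x = x}.
Hypothesis regG : sharply_transitive_on G (~: F).

Implicit Types (b c : {set V}) (P : {set {set V}}) (g s t : {perm V}).

Lemma fixF g x : g \in G -> x \in F -> g x = x.
Proof. by move=> Gg Fx; apply: fixG. Qed.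

Lemma card_block b : b \in B -> #|b| = 3.
Proof. by case: kts => -[card3 _] _; apply: card3. Qed.

Lemma block_through x y : x != y -> exists b, [/\ b \in B, x \in b & y \in b].
Proof.
case: kts => -[_ joinB] _ /joinB[b [[Bb sub_b] _]]; exists b; split=> //.
  by rewrite (subsetP sub_b) // !inE eqxx.
by rewrite (subsetP sub_b) // !inE eqxx orbT.
Qed.

Lemma eq_block b c x y :
    b \in B -> c \in B -> x != y ->
    x \in b -> y \in b -> x \in c -> y \in c ->
  b = c.
Proof.
case: kts => -[_ joinB] _ Bb Bc /joinB[d [_ uniq_d]] xb yb xc yc.
rewrite -(uniq_d b) ?(uniq_d c) //; split=> //.
  by apply/subsetP=> u; rewrite !inE => /orP[] /eqP->.
by apply/subsetP=> u; rewrite !inE => /orP[] /eqP->.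
Qed.

Arguments eq_block [b c] x y.

Lemma mem_aut_block g b : g \in G -> b \in B -> g @: b \in B.
Proof.
move/(subsetP autG); rewrite inE => /andP[/forall_inP autB _].
exact: autB.
Qed.

Lemma class_of_block b : b \in B -> exists2 P, P \in R & b \in P.
Proof.
case: kts => _ [partR _]; rewrite -(cover_partition partR).
by case/bigcupP=> P; exists P.
Qed.

Lemma class_block P b : P \in R -> b \in P -> b \in B.
Proof.
case: kts => _ [partR _] RP bP.
by rewrite -(cover_partition partR); apply/bigcupP; exists P.
Qed.

Lemma class_cover P x : P \in R -> exists2 b, b \in P & x \in b.
Proof.
case: kts => _ [_ partP] /partP /cover_partition covP.
have: x \in cover P by rewrite covP inE.
by case/bigcupP=> b; exists b.
Qed.

Lemma class_eq_block P b c x :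
  P \in R -> b \in P -> c \in P -> x \in b -> x \in c -> b = c.
Proof.
case: kts => _ [_ partP] /partP /and3P[_ /trivIsetP trivP _] bP cP xb xc.
by apply/eqP; apply: contraLR xc => /(trivP _ _ bP cP)/disjointFr->.
Qed.

(** If [g] fixes a block of a parallel class, the class and its image share
    that block and so coincide. *)
Lemma aut_class_stable g P b c :
  g \in G -> P \in R -> b \in P -> g @: b = b -> c \in P -> g @: c \in P.
Proof.
move/(subsetP autG); rewrite inE => /andP[_ /forall_inP autR] RP bP gb cP.
case: kts => _ [/and3P[_ /trivIsetP trivR _] _].
have bgP: b \in [set g @: d | d : {set V} in P] by rewrite -gb imset_f.
have eqP: P = [set g @: d | d : {set V} in P].
  apply/eqP; apply: contraTT bgP => /(trivR _ _ RP (autR _ RP)) disjP.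
  by rewrite (disjointFr disjP bP).
by rewrite eqP imset_f.
Qed.

(** The block of a parallel class through a fixed point is fixed along with
    the class. *)
Lemma aut_class_fixed_point g P b c z :
    g \in G -> P \in R -> b \in P -> g @: b = b ->
    c \in P -> z \in c -> z \in F ->
  g @: c = c.
Proof.
move=> Gg RP bP gb cP zc Fz.
apply: (class_eq_block (x := z) RP) => //; first exact: aut_class_stable gb cP.
by rewrite -(fixF Gg Fz) imset_f.
Qed.

Lemma regG_exists x y :
  x \notin F -> y \notin F -> exists2 g, g \in G & g x = y.
Proof.
move=> F'x F'y; have [||g [[Gg gx] _]] := regG (x := x) (y := y).
- by rewrite inE.
- by rewrite inE.
by exists g.
Qed.

Lemma mem_fixed g x : g \in G -> (g x \in F) = (x \in F).
Proof.
move=> Gg; apply/idP/idP => [Fgx | Fx]; last by rewrite (fixF Gg Fx).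
by rewrite -(perm_inj (fixF Gg Fgx)).
Qed.

Lemma regG_inj g h x : x \notin F -> g \in G -> h \in G -> g x = h x -> g = h.
Proof.
move=> F'x Gg Gh eq_gh; have [||k [_ uniq_k]] := regG (x := x) (y := g x).
- by rewrite inE.
- by rewrite inE mem_fixed.
by rewrite -(uniq_k g) // (uniq_k h).
Qed.

Lemma regG_neq g x : x \notin F -> g \in G -> g != 1 -> g x != x.
Proof.
move=> F'x Gg; apply: contra => /eqP gx.
by apply/eqP/(regG_inj F'x Gg (group1 G)); rewrite perm1.
Qed.

Lemma involutionP s :
  reflect [/\ s \in G, s != 1 & forall x, s (s x) = x] (s \in involutions G).
Proof.
rewrite inE; apply: (iffP andP) => [[Gs /eqP os] | [Gs nt_s ss]]; split=> //.
- by rewrite -order_gt1 os.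
- by move=> x; rewrite -permM -expg2 -os expg_order perm1.
apply/eqP/nt_prime_order => //.
by apply/permP=> x; rewrite expg2 permM ss perm1.
Qed.

Lemma involution_block_stable s b x :
    x \notin F -> s \in involutions G -> b \in B -> x \in b -> s x \in b ->
  s @: b = b.
Proof.
move=> F'x /involutionP[Gs nt_s ss] Bb xb sxb.
apply: (eq_block x (s x)) => //.
- exact: mem_aut_block.
- by rewrite eq_sym regG_neq.
- by rewrite -{1}(ss x) imset_f.
- exact: imset_f.
Qed.

(** The involution permutes the block and swaps two of its points, so it fixes
    the third, whereas its only fixed points are those of [F]. *)
Lemma fixed_point_of_involution s b x :
    x \notin F -> s \in involutions G -> b \in B -> x \in b -> s x \in b ->
  exists2 z, z \in F & z \in b.
Proof.
move=> F'x invs Bb xb sxb; have sb := involution_block_stable F'x invs Bb xb sxb.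
have /involutionP[Gs nt_s ss] := invs.
have [z [zb zx zsx]] := third_point x (s x) (card_block Bb).
exists z => //; apply: contraT => F'z.
have /eqP[] := regG_neq F'z Gs nt_s.
apply: (eq_third_point (card_block Bb) xb sxb) => //.
- by rewrite -sb imset_f.
- by rewrite eq_sym regG_neq.
- by rewrite -{1}(ss x) (inj_eq perm_inj).
- by rewrite (inj_eq perm_inj).
Qed.

Lemma involution_of_fixed_point b x z :
    G :!=: 1 -> x \notin F -> z \in F -> b \in B -> x \in b -> z \in b ->
  exists2 s, s \in involutions G & s x \in b.
Proof.
move=> ntG F'x Fz Bb xb zb.
have neqF y u: y \notin F -> u \in F -> y != u.
  by move=> F'y; apply: contraTneq => <-.
have [y [yb yx yz]] := third_point x z (card_block Bb).
have F'y: y \notin F.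
  (* a block with two points in [F] is fixed by all of [G], which moves [x] *)
  apply/negP=> Fy; have [g Gg nt_g] := trivgPn _ ntG.
  have gb: g @: b = b.
    apply: (eq_block y z) => //; first exact: mem_aut_block.
      by rewrite -(fixF Gg Fy) imset_f.
    by rewrite -(fixF Gg Fz) imset_f.
  have F'gx: g x \notin F by rewrite mem_fixed.
  have /eqP[] := regG_neq F'x Gg nt_g.
  apply: (eq_third_point (card_block Bb) yb zb) => //; try exact: neqF.
  by rewrite -gb imset_f.
have [s Gs sx] := regG_exists F'x F'y.
exists s; last by rewrite sx.
have nt_s: s != 1 by apply: contraNneq yx => s1; rewrite -sx s1 perm1.
have sb: s @: b = b.
  apply: (eq_block y z) => //; first exact: mem_aut_block.
    by rewrite -sx imset_f.
  by rewrite -(fixF Gs Fz) imset_f.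
have ssx: s (s x) = x.
  apply: (eq_third_point (card_block Bb) yb zb) => //.
  - by rewrite -sb imset_f // sx.
  - by rewrite eq_sym.
  - exact: neqF.
  - by rewrite sx regG_neq.
  - by apply: neqF; rewrite ?mem_fixed.
apply/involutionP; split=> // u; rewrite -permM -[RHS]perm1; congr ((_ : {perm V}) u).
by apply: (regG_inj F'x); rewrite ?groupM // permM ssx perm1.
Qed.

(** The third point of the block through [x] and [s x] determines the block,
    and inside it [s x] is the only point off [F] other than [x]. *)
Lemma eq_involution s t b x z :
    x \notin F -> z \in F -> s \in G -> s != 1 -> t \in G -> t != 1 ->
    b \in B -> x \in b -> z \in b -> s x \in b -> t x \in b ->
  s = t.
Proof.
move=> F'x Fz Gs nt_s Gt nt_t Bb xb zb sxb txb.
have neqF y: y \notin F -> y != z by apply: contraNneq => ->.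
apply: (regG_inj F'x) => //.
by apply: (eq_third_point (card_block Bb) xb zb) => //;
  rewrite ?regG_neq ?neqF ?mem_fixed.
Qed.

Lemma card_involutions x :
  G :!=: 1 -> x \notin F -> #|involutions G| = #|F|.
Proof.
move=> ntG F'x.
pose join s z := [exists b in B, [&& x \in b, s x \in b & z \in b]].
have joinP s z:
    reflect (exists b, [/\ b \in B, x \in b, s x \in b & z \in b]) (join s z).
  apply: (iffP exists_inP) => [[b Bb /and3P[]] | [b [Bb xb sxb zb]]].
    by exists b.
  by exists b => //; apply/and3P.
(* outside the involutions the value [x] is arbitrary *)
pose f s := odflt x [pick z in F | join s z].
have f_join s: s \in involutions G -> f s \in F /\ join s (f s).
  move=> invs; rewrite /f; case: pickP => [z /andP[] // | no_z].
  have /involutionP[Gs nt_s _] := invs.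
  have [|b [Bb xb sxb]] := @block_through x (s x).
    by rewrite eq_sym regG_neq.
  have [z Fz zb] := fixed_point_of_involution F'x invs Bb xb sxb.
  by case/andP: (no_z z); split=> //; apply/joinP; exists b.
have neqF z: z \in F -> x != z by apply: contraTneq => <-.
have <-: f @: involutions G = F.
  apply/setP=> z; apply/imsetP/idP => [[s invs ->] | Fz].
    by have [] := f_join s invs.
  have [b [Bb xb zb]] := block_through (neqF z Fz).
  have [s invs sxb] := involution_of_fixed_point ntG F'x Fz Bb xb zb.
  exists s => //; have [Ffs /joinP[c [Bc xc sxc fsc]]] := f_join s invs.
  have /involutionP[Gs nt_s _] := invs.
  have xsx: x != s x by rewrite eq_sym regG_neq.
  have eq_bc: b = c by apply: (eq_block x (s x)).
  have F'sx: s x \notin F by rewrite mem_fixed.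
  apply: (eq_third_point (card_block Bb) xb sxb) => //; first by rewrite eq_bc.
  - by rewrite eq_sym neqF.
  - by apply: contraNneq F'sx => <-.
  - by rewrite eq_sym neqF.
  - by apply: contraNneq F'sx => <-.
rewrite card_in_imset // => s t invs invt eq_f.
have [Ffs /joinP[b [Bb xb sxb fsb]]] := f_join s invs.
have [_ /joinP[c [Bc xc txc]]] := f_join t invt; rewrite -eq_f => fsc.
have eq_bc: b = c by apply: (eq_block x (f s)) => //; apply: neqF.
have /involutionP[Gs nt_s _] := invs; have /involutionP[Gt nt_t _] := invt.
by apply: (eq_involution F'x Ffs Gs nt_s Gt nt_t Bb); rewrite // eq_bc.
Qed.

(** The involution [s] preserves every block of the parallel class of
    {x, s x, z} that meets [F].  The block of this class through [w] thus
    exhibits a conjugate of [s] as the involution attached to [w], unless it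
    lies in [F], in which case [t] preserves {x, s x, z} and equals [s]. *)
Lemma involutions_conjugate x :
    x \notin F ->
  {in involutions G &, forall s t, exists2 g, g \in G & t = s ^ g}.
Proof.
move=> F'x s t invs invt.
have /involutionP[Gs nt_s _] := invs; have /involutionP[Gt nt_t _] := invt.
have [|b [Bb xb sxb]] := @block_through x (s x).
  by rewrite eq_sym regG_neq.
have [|d [Bd xd txd]] := @block_through x (t x).
  by rewrite eq_sym regG_neq.
have [z Fz zb] := fixed_point_of_involution F'x invs Bb xb sxb.
have [w Fw wd] := fixed_point_of_involution F'x invt Bd xd txd.
have sb := involution_block_stable F'x invs Bb xb sxb.
have [P RP bP] := class_of_block Bb.
have [c cP wc] := class_cover w RP.
have Bc := class_block RP cP.
have sc: s @: c = c by apply: aut_class_fixed_point sb cP wc Fw.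
have [cF | /subsetPn[y yc F'y]] := boolP (c \subset F).
  have tc: t @: c = c.
    rewrite -[RHS]imset_id; apply: eq_in_imset => u uc.
    by rewrite (fixF Gt) // (subsetP cF).
  have tb: t @: b = b by apply: aut_class_fixed_point tc bP zb Fz.
  exists 1; rewrite // conjg1; apply/esym.
  apply: (eq_involution F'x Fz Gs nt_s Gt nt_t Bb) => //.
  by rewrite -tb imset_f.
have [h Gh hx] := regG_exists F'x F'y.
have GhV: h^-1 \in G by rewrite groupV.
exists h^-1 => //.
have xhc: x \in h^-1 @: c by rewrite -(permK h x) hx imset_f.
have eq_d: h^-1 @: c = d.
  apply: (eq_block x w) => //; first exact: mem_aut_block.
    by apply: contraNneq F'x => ->.
  by rewrite -(fixF GhV Fw) imset_f.
apply/esym/(eq_involution F'x Fw _ _ Gt nt_t Bd xd wd _ txd).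
- by rewrite groupJ.
- by rewrite conjg_eq1.
by rewrite conjgE invgK !permM hx -eq_d imset_f // -sc imset_f.
Qed.

End Pyramidal.

(** * Transfer to the abstract group *)

Lemma involutions_injm (aT rT : finGroupType) (A : {group aT})
    (f : {morphism A >-> rT}) :
  'injm f -> involutions (f @* A) = f @: involutions A.
Proof.
move=> injf; apply/setP=> y; apply/idP/imsetP => [|[x]].
  rewrite inE => /andP[/morphimP[x Ax _ ->]]; rewrite order_injm // => ox.
  by exists x; rewrite // inE Ax.
rewrite inE => /andP[Ax ox] ->; rewrite inE order_injm // ox andbT.
exact: mem_morphim.
Qed.

Unset Implicit Arguments.

Theorem proposition1p1 (m : nat) (hm : (1 <= m)%N)
    (gT : finGroupType) (G : {group gT}) (ntG : G :!=: 1)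
    (hG : pyramidal_kts_realized_under m G) :
  #|involutions G| = m /\
  {in involutions G &, forall x y, exists2 g, g \in G & y = x ^ g}.
Proof.
have [V [B [R [H [kts [autH [F [cardF fixF regH]]] isoGH]]]]] := hG.
have ntH: H :!=: 1 by rewrite -(isog_eq1 isoGH).
have [x F'x]: exists x, x \notin F.
  have [h Hh nt_h] := trivgPn _ ntH.
  apply/existsP; apply: contraR nt_h => /existsPn allF.
  by apply/eqP/permP=> x; rewrite perm1 fixF //; apply/negbNE/allF.
have [f injf fG] := isogP isoGH.
have invH: involutions H = f @: involutions G by rewrite -fG involutions_injm.
have subG: {subset involutions G <= G} by move=> s; rewrite inE => /andP[].
split.
  rewrite -cardF -(card_involutions kts autH fixF regH ntH F'x) invH.
  rewrite card_in_imset // => s t /subG Gs /subG Gt.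
  exact: (injmP injf).
move=> s t invs invt.
have [Gs Gt] := (subG s invs, subG t invt).
have Hfs: f s \in involutions H by rewrite invH imset_f.
have Hft: f t \in involutions H by rewrite invH imset_f.
have [h] := involutions_conjugate kts autH fixF regH F'x Hfs Hft.
rewrite -fG => /morphimP[g Gg _ ->]; rewrite -morphJ // => eq_f.
by exists g => //; apply: (injmP injf) eq_f; rewrite ?groupJ.
Qed.
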